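(* Any finite group $\Gamma$ is the automorphism group of finite graphs of unbounded clique number. That is, for every finite group $\Gamma$ and every positive integer $k$ there exists a finite graph $H$ with $\operatorname{Aut}(H)\cong\Gamma$ and clique number $\omega(H)\geq k$.
   Context: Graphs are simple and undirected. $\operatorname{Aut}(H)$ denotes the group of graph automorphisms of $H$, and $\cong$ denotes isomorphism of groups. The clique number $\omega(H)$ is the largest number of vertices in a set of pairwise adjacent vertices of $H$. *)

(* Defs.v *)
From HB Require Import structures.
From mathcomp Require Import all_boot all_fingroup.

Set Implicit Arguments.
Unset Strict Implicit.
Unset Printing Implicit Defensive.

Record sgraph := SGraph {
  vertex :> finType;
  adj : rel vertex;
  adj_sym : symmetric adj;
  adj_irrefl : irreflexive adj
}.

Section GraphNotions.
Variable H : sgraph.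

(* The Boolean equality makes s both preserve and reflect adjacency. *)
Definition graph_aut : {set {perm H}} :=
  [set s : {perm H} | [forall x, forall y, adj (s x) (s y) == adj x y]].

Lemma graph_autP (s : {perm H}) :
  reflect (forall x y, adj (s x) (s y) = adj x y) (s \in graph_aut).
Proof.
rewrite inE; apply: (iffP forallP) => [h x y | h x].
  by move/forallP: (h x) => /(_ y)/eqP.
by apply/forallP => y; apply/eqP.
Qed.

Lemma graph_aut_group_set : group_set graph_aut.
Proof.
apply/group_setP; split=> [|s t /graph_autP hs /graph_autP ht].
  by apply/graph_autP => x y; rewrite !perm1.
by apply/graph_autP => x y; rewrite !permM ht hs.
Qed.

Canonical graph_aut_group := Group graph_aut_group_set.

Definition is_clique (A : {set H}) : bool :=
  [forall x in A, forall y in A, (x != y) ==> adj x y].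

Definition clique_number : nat := \max_(A : {set H} | is_clique A) #|A|.

End GraphNotions.

(* Main.v *)
Require Import Defs.
From HB Require Import structures.
From mathcomp Require Import all_boot all_fingroup.
From mathcomp Require Import zmodp zify.

Set Implicit Arguments.
Unset Strict Implicit.
Unset Printing Implicit Defensive.

(** Let W be a finite group of order at least 3 containing Gamma, and take m
    layers 0, ..., m - 1, each a copy of W.  Layers i and j with i + j >= m are
    completely joined (for i = j the layer is a clique), all other pairs i <> j
    are joined by a perfect matching x -- s_ij x.  A vertex of layer i then has
    m + i (|W| - 1) vertices in its closed neighbourhood, so automorphisms
    preserve the layers (the bound |W| >= 3 leaves room for the extra vertex
    below, which adds 1 on part of layer 0).  The matchings from layer 0 are identities, hence an
    automorphism acts by the same permutation of W on each layer; the matchings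
    from layer 1 realise all left translations, hence this permutation commutes
    with them and is a right translation.  One further vertex, joined to the
    subset Gamma of layer 0, cuts the right translations down to Gamma; its degree
    is too small for it to be confused with a layer vertex.  The upper half of the
    layers is a clique. *)

Definition closed_degree (H : sgraph) (v : H) : nat :=
  #|[pred u | (u == v) || adj v u]|.

Lemma closed_degree_aut (H : sgraph) (s : {perm H}) (v : H) :
  s \in graph_aut H -> closed_degree (s v) = closed_degree v.
Proof.
move=> /graph_autP sA; rewrite /closed_degree -[RHS](card_image (@perm_inj _ s)).
apply: eq_card => u; rewrite -[u](permKV s) mem_image; last exact: perm_inj.
by rewrite !inE (inj_eq perm_inj) sA.
Qed.

Lemma clique_number_ge (H : sgraph) (A : {set H}) :
  is_clique A -> #|A| <= clique_number H.
Proof. by move=> cA; rewrite /clique_number (bigD1 A) //= leq_maxl. Qed.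

Section LayeredGraph.

Variables (W : finGroupType) (Gamma : {group W}) (k : nat).

(** The first summand leaves room for a layer [j.+2] for each [j < #|W|], joined to layer 1 by a
    matching only; the last [k] layers will form the clique. *)
Definition nlayers : nat := (#|W| + k).+3 + k.

(* Layer j.+2 carries the j-th element of [enum W]. *)
Definition shift (i j : nat) : W :=
  if (i == 1) && (1 < j) then nth 1%g (enum W) (j - 2)
  else if (j == 1) && (1 < i) then (nth 1 (enum W) (i - 2))^-1%g
  else 1%g.

Lemma shiftV i j : ((shift i j)^-1 = shift j i)%g.
Proof.
rewrite /shift; case: i => [|[|i]]; case: j => [|[|j]] //=;
  by rewrite ?invg1 ?invgK.
Qed.

Lemma shiftii i : shift i i = 1%g.
Proof. by rewrite /shift; case: i => [|[|i]]. Qed.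

Lemma shift0 j : shift 0 j = 1%g.
Proof. by rewrite /shift andbF. Qed.

Lemma shift1_surj (g : W) :
  exists j : nat, [/\ 1 < j, 1 + j < nlayers & shift 1 j = g].
Proof.
exists (index g (enum W)).+2.
have lt : index g (enum W) < #|W| by rewrite cardE index_mem mem_enum.
split=> //; first by rewrite /nlayers; lia.
by rewrite /shift /= !subSS subn0 nth_index // mem_enum.
Qed.

Definition layer_close (p q : W * 'I_nlayers) : bool :=
  (nlayers <= p.2 + q.2) || (q.1 == shift p.2 q.2 * p.1)%g.

Lemma layer_close_sym : symmetric layer_close.
Proof.
move=> [x i] [y j]; rewrite /layer_close /= addnC; congr (_ || _).
by rewrite -(shiftV i j) eq_sym -(inj_eq (mulgI (shift i j)^-1%g)) mulKg.
Qed.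

Lemma layer_close_refl : reflexive layer_close.
Proof. by move=> [x i]; rewrite /layer_close /= shiftii mul1g eqxx orbT. Qed.

Definition layered_adj (u v : option (W * 'I_nlayers)) : bool :=
  match u, v with
  | Some p, Some q => (p != q) && layer_close p q
  | None, Some p | Some p, None => (p.2 == 0 :> nat) && (p.1 \in Gamma)
  | None, None => false
  end.

Lemma layered_adj_sym : symmetric layered_adj.
Proof. by move=> [p|] [q|] //=; rewrite eq_sym layer_close_sym. Qed.

Lemma layered_adj_irrefl : irreflexive layered_adj.
Proof. by move=> [p|] //=; rewrite eqxx. Qed.

Definition layered_graph : sgraph := SGraph layered_adj_sym layered_adj_irrefl.

(** Each layer contributes one matched vertex, or all of [W] when completely joined; the latter
    happens for exactly [p.2] layers. *)
Lemma card_layer_close p :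
  #|[pred q | layer_close p q]| = nlayers + p.2 * #|W|.-1.
Proof.
case: p => x i; rewrite -sum1_card big_mkcond /=.
pose F y (j : 'I_nlayers) : nat :=
  if (nlayers <= i + j) || (y == shift i j * x)%g then 1 else 0.
rewrite (eq_bigr (fun q => F q.1 q.2)) // -(pair_bigA _ F) exchange_big /=.
have row j : \sum_y F y j = 1 + (nlayers <= i + j) * #|W|.-1.
  rewrite /F; case: leqP => _ /=.
    by rewrite -big_mkcond sum1_card card1.
  by rewrite sum1_card mul1n add1n prednK // -cardsT cardG_gt0.
rewrite (eq_bigr _ (fun j _ => row j)) big_split /= sum1_card card_ord.
(* Reversing the index [j] turns [nlayers <= i + j] into [j < i]. *)
rewrite -big_distrl /= (reindex_inj rev_ord_inj) /=; congr (_ + _ * _).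
rewrite (eq_bigr (fun j : 'I_nlayers => (j < i : nat))); last first.
  move=> j _; congr nat_of_bool; move: (ltn_ord j) (ltn_ord i); lia.
rewrite -big_mkcond /= -(big_ord_widen _ (fun=> 1)) ?sum1_card ?card_ord //.
exact: ltnW.
Qed.

Lemma closed_degree_layer (p : W * 'I_nlayers) :
  closed_degree (Some p : layered_graph) =
    nlayers + p.2 * #|W|.-1 + ((p.2 == 0 :> nat) && (p.1 \in Gamma)).
Proof.
rewrite /closed_degree -card_layer_close -!sum1_card [LHS]big_mkcond /=.
rewrite (bigD1 None) //= addnC; congr (_ + _).
rewrite [RHS]big_mkcond (reindex_omap Some id) /=; last by case.
apply: eq_big => [q|q _]; first by rewrite /= eqxx.
rewrite !inE /= (inj_eq Some_inj) eq_sym.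
by case: eqVneq => // ->; rewrite layer_close_refl.
Qed.

Lemma closed_degree_None : closed_degree (None : layered_graph) = #|Gamma|.+1.
Proof.
rewrite /closed_degree (cardD1 None) !inE eqxx add1n; congr _.+1.
rewrite -(card_imset (mem Gamma) (f := fun x => Some (x, ord0 : 'I_nlayers))).
  apply: eq_card => -[[x i]|]; rewrite !inE /=; last first.
    by apply/esym/negP => /imsetP[].
  apply/andP/imsetP => [[/eqP i0 xG]|[y yG [-> ->]] //].
  by exists x => //; congr (Some (_, _)); apply: val_inj.
by move=> x y [].
Qed.

Hypothesis W_gt2 : 2 < #|W|.

Section Rigidity.

Variable s : {perm layered_graph}.
Hypothesis sA : s \in graph_aut layered_graph.

Lemma aut_None : s None = None.
Proof.
case E: (s None) => [p|] //; have := closed_degree_aut (None : layered_graph) sA.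
rewrite E closed_degree_layer closed_degree_None /nlayers.
(* Hence [#|Gamma|.+1 < nlayers], below every closed degree in a layer. *)
have : #|Gamma| <= #|W| := max_card _.
move: (p.2 * _) => c; lia.
Qed.

Lemma aut_layer x i : exists y, s (Some (x, i)) = Some (y, i).
Proof.
case E: (s (Some (x, i))) => [[y j]|]; last first.
  by move: E; rewrite -aut_None => /perm_inj.
exists y; congr (Some (_, _)); apply: val_inj.
have := closed_degree_aut (Some (x, i) : layered_graph) sA; rewrite E !closed_degree_layer /=.
(* Distinct layers differ by at least [#|W|.-1 >= 2], more than the extra vertex can offset. *)
move: W_gt2; case: #|W| => [|[|[|c]]] //= _.
by case: (_ && _); case: (_ && _); case: (ltngtP i j) => //=; nia.
Qed.

Definition layer_action (i : 'I_nlayers) (x : W) : W :=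
  if s (Some (x, i)) is Some p then p.1 else 1%g.

Lemma layer_actionE x i : s (Some (x, i)) = Some (layer_action i x, i).
Proof. by rewrite /layer_action; have [y ->] := aut_layer x i. Qed.

(** Between two such layers the only edges are those of the matching, so matched pairs go to matched
    pairs. *)
Lemma layer_action_shift (i j : 'I_nlayers) x : i != j -> i + j < nlayers ->
  layer_action j (shift i j * x)%g = (shift i j * layer_action i x)%g.
Proof.
move=> neq lt; move/graph_autP: sA => sA'.
have := sA' (Some (x, i)) (Some ((shift i j * x)%g, j)).
rewrite !layer_actionE /= /layer_close /= leqNgt lt /= eqxx.
rewrite -!pair_eqE /= /pair_eq /= (negbTE neq) !andbF /=.
by move/eqP.
Qed.

Lemma layer_action_const i x : layer_action i x = layer_action ord0 x.
Proof.
have [->//|neq] := eqVneq i ord0.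
have := @layer_action_shift ord0 i x; rewrite shift0 !mul1g eq_sym => -> //; exact: ltn_ord.
Qed.

Lemma layer_action_mul g x :
  layer_action ord0 (g * x)%g = (g * layer_action ord0 x)%g.
Proof.
have [j [j_gt1 lt <-]] := shift1_surj g.
have lt1 : 1 < nlayers by lia.
have ltj : j < nlayers by lia.
have := @layer_action_shift (Ordinal lt1) (Ordinal ltj) x.
rewrite !(layer_action_const (Ordinal _)) /=; apply => //.
by rewrite -val_eqE /=; lia.
Qed.

Lemma aut_right_translation :
  exists2 a, a \in Gamma & forall x i, s (Some (x, i)) = Some ((x * a)%g, i).
Proof.
exists (layer_action ord0 1%g) => [|x i].
  (* The fixed vertex [None] is adjacent to the identity of layer 0, hence also to its image. *)
  move/graph_autP: sA => /(_ None (Some (1%g, ord0))).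
  by rewrite aut_None layer_actionE /= group1.
by rewrite layer_actionE layer_action_const -{1}[x]mulg1 layer_action_mul.
Qed.

End Rigidity.

Definition right_translate (a : W) (v : layered_graph) : layered_graph :=
  omap (fun p : W * 'I_nlayers => ((p.1 * a)%g, p.2)) v.

Lemma right_translate_inj a : injective (right_translate a).
Proof. by move=> [[x i]|] [[y j]|] //= [/mulIg -> ->]. Qed.

Definition right_perm a : {perm layered_graph} := perm (@right_translate_inj a).

Lemma right_permM : {in Gamma &, {morph right_perm : a b / (a * b)%g}}.
Proof.
move=> a b _ _; apply/permP => v; rewrite permM !permE.
by case: v => [[x i]|] //=; rewrite mulgA.
Qed.

Canonical right_perm_morphism := Morphism right_permM.

Lemma right_perm_aut a : a \in Gamma -> right_perm a \in graph_aut layered_graph.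
Proof.
move=> aG; apply/graph_autP => u v; rewrite !permE.
case: u v => [[x i]|] [[y j]|] //=; rewrite ?groupMr //.
by rewrite /layer_close -!pair_eqE /pair_eq /= mulgA !(inj_eq (mulIg a)).
Qed.

Lemma graph_aut_layered_graph : graph_aut layered_graph \isog Gamma.
Proof.
rewrite isog_sym; apply/isogP; exists right_perm_morphism.
  apply/injmP => a b _ _ /permP/(_ (Some (1%g, ord0))).
  by rewrite !permE /= !mul1g => -[].
apply/setP => s; rewrite morphimEdom.
apply/imsetP/idP => [[a aG ->]|sA]; first exact: right_perm_aut.
have [a aG sE] := aut_right_translation sA.
exists a => //; apply/permP => -[[x i]|]; rewrite permE /= ?sE //.
exact: aut_None.
Qed.

Lemma clique_number_layered_graph : k <= clique_number layered_graph.
Proof.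
pose f (i : 'I_k) : layered_graph :=
  Some (1%g, rshift (#|W| + k).+3 i : 'I_nlayers).
have f_inj : injective f by move=> i j [/addnI]; apply: val_inj.
rewrite -[X in X <= _]card_ord -cardsT -(card_imset _ f_inj).
apply: clique_number_ge; apply/forall_inP => _ /imsetP[i _ ->].
apply/forall_inP => _ /imsetP[j _ ->]; apply/implyP => neq.
rewrite /= -(inj_eq Some_inj) neq /layer_close /=.
(* Both layer indices are at least [(#|W| + k).+3], so their sum reaches [nlayers]. *)
apply/orP; left; apply: leq_trans (leq_add (leq_addr _ _) (leq_addr _ _)).
by rewrite leq_add2l !leqW // leq_addl.
Qed.

End LayeredGraph.

Theorem mainTheorem3 (gT : finGroupType) (Gamma : {group gT}) (k : nat)
    (hk : 0 < k) :
  exists H : sgraph, graph_aut H \isog Gamma /\ k <= clique_number H.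
Proof.
(* The factor ['I_3], cyclic of order 3, ensures [2 < #|W|] even for trivial [gT]. *)
exists (layered_graph (@pairg1 gT 'I_3 @* Gamma)%G k); split.
  apply: isog_trans (graph_aut_layered_graph _ _ _) _.
    have : 0 < #|gT| by apply/card_gt0P; exists 1%g.
    by rewrite card_prod card_ord => gT_gt0; apply: (leq_mul gT_gt0 (leqnn 3)).
  by rewrite isog_sym sub_isog ?subsetT ?injm_pairg1.
exact: clique_number_layered_graph.
Qed.
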